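(* Let $n\in\mathbb{N}$ and let $q\in\mathbb{C}$ be nonzero. Let $\Phi(q)$ and $\Psi(q)$ be the linear endomorphisms of the space $\mathbb{C}^n[X]$ of complex polynomials of degree at most $n$ defined, for $p(X)=\sum_{k=0}^na_kX^k$, by $$\Phi(q)p=\sum_{k=0}^na_k(1+X)^k_q,\qquad \Psi(q)p=\sum_{k=0}^na_k\,q_{n-k}\,(1-X)^{n-k}_{q^{-1}}X^k .$$ Then $\Phi(q)\Psi(q)\Phi(q)=\Psi(q)\Phi(q)\Psi(q)$.
   Context: $\mathbb{N}=\{0,1,2,\dots\}$. $q_k:=q^{k(k-1)/2}$. For $k\in\mathbb{N}$, $(1+x)^k_q:=(1+x)(1+xq)(1+xq^2)\cdots(1+xq^{k-1})$ (the empty product $1$ for $k=0$); thus $(1-X)^{m}_{q^{-1}}=(1-X)(1-q^{-1}X)\cdots(1-q^{-(m-1)}X)$. *)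

(* Defs.v *)
From HB Require Import structures.
From mathcomp Require Import all_boot all_order all_algebra.
From mathcomp Require Export reals.
From mathcomp.real_closed Require Export complex.

Set Implicit Arguments.
Unset Strict Implicit.
Unset Printing Implicit Defensive.

Import GRing.Theory.
Local Open Scope ring_scope.

(* [C^n[X]], the polynomials of degree at most [n], is [{poly_n.+1 C}]:
   [{poly_m F}] bounds the size, which is the degree plus one. *)

(* [(1 + x)^k_q], with [x] an arbitrary polynomial; [(1 - X)^k_q] is the case
   [x = - 'X]. *)
Definition qpow1 (F : fieldType) (q : F) (x : {poly F}) (k : nat) : {poly F} :=
  \prod_(i < k) (1 + q ^+ i *: x).

Definition qtri (F : fieldType) (q : F) (k : nat) : F :=
  q ^+ ((k * (k - 1)) %/ 2).

Definition Phi_poly (F : fieldType) (n : nat) (q : F) (p : {poly F}) :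
    {poly F} :=
  \sum_(k < n.+1) p`_k *: qpow1 q 'X k.

Definition Psi_poly (F : fieldType) (n : nat) (q : F) (p : {poly F}) :
    {poly F} :=
  \sum_(k < n.+1) p`_k *: (qtri q (n - k) *: (qpow1 q^-1 (- 'X) (n - k) * 'X^k)).

Lemma size_qpow1 (F : fieldType) (q : F) (x : {poly F}) (k : nat) :
  (size x <= 2)%N -> (size (qpow1 q x k) <= k.+1)%N.
Proof.
move=> sx; rewrite /qpow1; elim: k => [|k IH].
  by rewrite big_ord0 size_poly1.
rewrite big_ord_recr /= (leq_trans (size_polyMleq _ _)) //.
have s2 : (size (1 + q ^+ k *: x)%R <= 2)%N.
  rewrite (leq_trans (size_polyD _ _)) // geq_max size_poly1 /=.
  exact: leq_trans (size_scale_leq _ _) sx.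
by have := leq_add IH s2; rewrite addn2; case: (_ + _)%N.
Qed.

Lemma size_Phi_poly (F : fieldType) (n : nat) (q : F) (p : {poly F}) :
  (size (Phi_poly n q p) <= n.+1)%N.
Proof.
apply: (leq_trans (size_sum _ _ _)); apply/bigmax_leqP => k _.
apply: (leq_trans (size_scale_leq _ _)).
by apply: (leq_trans (size_qpow1 _ _ _)); rewrite ?size_polyX // ltn_ord.
Qed.

Lemma size_Psi_poly (F : fieldType) (n : nat) (q : F) (p : {poly F}) :
  (size (Psi_poly n q p) <= n.+1)%N.
Proof.
apply: (leq_trans (size_sum _ _ _)); apply/bigmax_leqP => k _.
do 2 apply: (leq_trans (size_scale_leq _ _)).
apply: (leq_trans (size_polyMleq _ _)); rewrite size_polyXn addnS /=.
have : (size (qpow1 q^-1 (- 'X) (n - k)) <= (n - k).+1)%N.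
  by apply: size_qpow1; rewrite size_polyN size_polyX.
by rewrite -(leq_add2r k) addSn subnK // -ltnS.
Qed.

Definition Phi_fun (F : fieldType) (n : nat) (q : F) (p : {poly_n.+1 F}) :
  {poly_n.+1 F} := NPoly (size_Phi_poly n q p).

Definition Psi_fun (F : fieldType) (n : nat) (q : F) (p : {poly_n.+1 F}) :
  {poly_n.+1 F} := NPoly (size_Psi_poly n q p).

Lemma Phi_fun_linear (F : fieldType) (n : nat) (q : F) :
  linear (@Phi_fun F n q).
Proof.
move=> a u v; apply/val_inj; rewrite /= /Phi_poly scaler_sumr -big_split /=.
by apply: eq_bigr => k _; rewrite coefD coefZ scalerDl scalerA.
Qed.

Lemma Psi_fun_linear (F : fieldType) (n : nat) (q : F) :
  linear (@Psi_fun F n q).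
Proof.
move=> a u v; apply/val_inj; rewrite /= /Psi_poly scaler_sumr -big_split /=.
by apply: eq_bigr => k _; rewrite coefD coefZ scalerDl scalerA.
Qed.

HB.instance Definition _ (F : fieldType) (n : nat) (q : F) :=
  GRing.isLinear.Build F {poly_n.+1 F} {poly_n.+1 F} _ (@Phi_fun F n q)
    (@Phi_fun_linear F n q).

HB.instance Definition _ (F : fieldType) (n : nat) (q : F) :=
  GRing.isLinear.Build F {poly_n.+1 F} {poly_n.+1 F} _ (@Psi_fun F n q)
    (@Psi_fun_linear F n q).

Definition Phi (F : fieldType) (n : nat) (q : F) : 'End({poly_n.+1 F}) :=
  linfun (@Phi_fun F n q).

Definition Psi (F : fieldType) (n : nat) (q : F) : 'End({poly_n.+1 F}) :=
  linfun (@Psi_fun F n q).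

Lemma PhiE (F : fieldType) (n : nat) (q : F) (p : {poly_n.+1 F}) :
  Phi n q p = \sum_(k < n.+1) p`_k *: qpow1 q 'X k :> {poly F}.
Proof. by rewrite lfunE. Qed.

Lemma PsiE (F : fieldType) (n : nat) (q : F) (p : {poly_n.+1 F}) :
  Psi n q p =
    \sum_(k < n.+1)
      p`_k *: (qtri q (n - k) *: (qpow1 q^-1 (- 'X) (n - k) * 'X^k))
  :> {poly F}.
Proof. by rewrite lfunE. Qed.

(* Main.v *)
Require Import Defs.
From HB Require Import structures.
From mathcomp Require Import all_boot all_order all_algebra.
From mathcomp Require Import ring.
Local Open Scope ring_scope.
Local Open Scope complex_scope.

Set Implicit Arguments.
Unset Strict Implicit.
Unset Printing Implicit Defensive.

Import GRing.Theory.

(** Write [A_k = (1 + X)^k_q] and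
    [E_m = \prod_(i < m) (q^i - X) = q_m (1 - X)^m_{q^-1}], so that
    [Phi X^k = A_k] and [Psi X^k = E_(n-k) X^k].  The identities
    [Psi_(n+1) ((1 + X) p(X)) = q^n Psi_n (p(X / q))] and
    [Phi ((1 - X) p(X)) = - X Phi (p(q X))] yield by induction
    [q_(n-k) Psi A_k = q_n E_(n-k)] and [Phi E_m = q_m (- X)^m].  Hence
    [Phi Psi Phi = q_n R], where [R X^k = (- X)^(n-k)].  Moreover
    [R Psi = Phi R], so [Phi (Psi Phi Psi) = q_n R Psi = Phi (q_n R)], and
    [Phi] is injective because [Phi Psi Phi] is, as [R^2 = (-1)^n]. *)

(** * Linear maps given by the images of monomials *)

Section CoefSum.
Variable F : fieldType.
Implicit Types (f : nat -> {poly F}) (p : {poly F}).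

(** Acting on all of [{poly F}] and ignoring the coefficients from [m] on, it lets the degree bound
    vary in the inductions without a change of type. *)
Definition coefsum (m : nat) f p : {poly F} := \sum_(k < m) p`_k *: f k.

Lemma coefsum_is_linear m f : linear (coefsum m f).
Proof.
move=> a u v; rewrite /coefsum scaler_sumr -big_split /=.
by apply: eq_bigr => k _; rewrite coefD coefZ scalerDl scalerA.
Qed.

HB.instance Definition _ m f :=
  GRing.isLinear.Build F {poly F} {poly F} _ (coefsum m f)
    (@coefsum_is_linear m f).

Lemma coefsum_comp (g : {linear {poly F} -> {poly F}}) m f p :
  g (coefsum m f p) = coefsum m (fun k => g (f k)) p.
Proof. by rewrite linear_sum; apply: eq_bigr => k _; rewrite linearZ. Qed.

Lemma coefsumZ a m f p :
  a *: coefsum m f p = coefsum m (fun k => a *: f k) p.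
Proof.
by rewrite /coefsum scaler_sumr; apply: eq_bigr => k _; rewrite !scalerA mulrC.
Qed.

Lemma eq_coefsum m f g p : (forall k, (k < m)%N -> f k = g k) ->
  coefsum m f p = coefsum m g p.
Proof. by move=> fg; apply: eq_bigr => k _; rewrite fg. Qed.

Lemma coefsumXn m f k : (k < m)%N -> coefsum m f 'X^k = f k.
Proof.
move=> ltkm; rewrite /coefsum (bigD1 (Ordinal ltkm)) //= big1 ?addr0.
  by rewrite coefXn eqxx scale1r.
by move=> i ne_i; rewrite coefXn (negPf (ne_i : nat_of_ord i != k)) scale0r.
Qed.

Lemma coefsumXM m f p :
  coefsum m.+1 f ('X * p) = coefsum m (fun k => f k.+1) p.
Proof.
rewrite /coefsum big_ord_recl coefXM scale0r add0r.
by apply: eq_bigr => k _; rewrite coefXM.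
Qed.

Lemma coefsum_recr m f p : (size p <= m)%N ->
  coefsum m.+1 f p = coefsum m f p.
Proof.
by move=> sp; rewrite /coefsum big_ord_recr /= nth_default // scale0r addr0.
Qed.

Lemma coefsum_id m p : (size p <= m)%N -> coefsum m (fun k => 'X^k) p = p.
Proof.
move=> sp; rewrite /coefsum -(poly_def m (fun k => p`_k)).
apply/polyP => i; rewrite coef_poly; case: ltnP => // mi.
by rewrite nth_default // (leq_trans sp).
Qed.

Lemma coef_comp_scaleX p (c : F) i : (p \Po (c *: 'X))`_i = p`_i * c ^+ i.
Proof.
rewrite coef_comp_poly; have [ltip|leip] := ltnP i (size p).
  rewrite (bigD1 (Ordinal ltip)) //= big1 ?addr0.
    by rewrite exprZn coefZ coefXn eqxx mulr1.
  move=> j; rewrite exprZn coefZ coefXn -val_eqE /= eq_sym => /negPf ->.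
  by rewrite !mulr0.
rewrite nth_default // mul0r big1 // => j _.
rewrite exprZn coefZ coefXn gtn_eqF ?mulr0 //.
exact: leq_trans (ltn_ord j) leip.
Qed.

End CoefSum.

(** * Triangular powers of [q] and q-products *)

Section QBraid.
Variables (F : fieldType) (q : F).
Implicit Types (p : {poly F}) (n m k : nat).

Lemma qtriS m : qtri q m.+1 = q ^+ m * qtri q m.
Proof.
(* The exponents are the binomials ['C(m, 2)], so this is Pascal's rule. *)
rewrite /qtri -exprD; congr (_ ^+ _); rewrite !subn1 !divn2 /=.
by rewrite -(bin2 m) -[(m.+1 * m)%N]/((m.+1 * m.+1.-1)%N) -bin2 binS bin1 addnC.
Qed.

Local Notation A := (qpow1 q 'X).

Lemma qpow1S (c : F) x k : qpow1 c x k.+1 = (1 + c ^+ k *: x) * qpow1 c x k.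
Proof. by rewrite /qpow1 big_ord_recr /= mulrC. Qed.

Lemma qpow1S_dilate k : A k.+1 = (1 + 'X) * qpow1 q (q *: 'X) k.
Proof.
rewrite /qpow1 big_ord_recl expr0 scale1r; congr (_ * _).
by apply: eq_bigr => i _; rewrite scalerA exprSr.
Qed.

Lemma qpow1_comp x y k : qpow1 q x k \Po y = qpow1 q (x \Po y) k.
Proof.
rewrite /qpow1 rmorph_prod; apply: eq_bigr => i _ /=.
by rewrite comp_polyD comp_polyZ rmorph1.
Qed.

Definition qfall m : {poly F} := \prod_(i < m) ((q ^+ i)%:P - 'X).

Local Notation E := qfall.

Lemma qfallS m : E m.+1 = ((q ^+ m)%:P - 'X) * E m.
Proof. by rewrite /qfall big_ord_recr /= mulrC. Qed.

Lemma size_prod_CsubX (c : nat -> F) m :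
  size (\prod_(i < m) ((c i)%:P - 'X)) = m.+1.
Proof.
under eq_bigr => i _ do rewrite -opprB.
by rewrite prodrN size_Msign size_prod_XsubC /index_enum -enumT size_enum_ord.
Qed.

Lemma qfall_qpow1 m : q != 0 -> qtri q m *: qpow1 q^-1 (- 'X) m = E m.
Proof.
move=> q0; elim: m => [|m IH].
  by rewrite /qpow1 /qfall !big_ord0 /qtri mul0n div0n expr0 scale1r.
rewrite qfallS -IH qtriS qpow1S -!mul_polyC polyCM.
have -> : (q ^+ m)%:P - 'X = (q ^+ m)%:P * (1 + (q^-1 ^+ m)%:P * - 'X).
  by rewrite mulrDr mulr1 mulrA -polyCM -exprMn divff // expr1n mul1r.
ring.
Qed.

(** * The maps Psi, Phi and the signed reversal *)

Definition psi_basis n k : {poly F} := E (n - k) * 'X^k.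

Local Notation T := psi_basis.

Lemma Psi_polyE n p : q != 0 -> Psi_poly n q p = coefsum n.+1 (T n) p.
Proof.
move=> q0; apply: eq_bigr => k _.
by rewrite scalerAl qfall_qpow1.
Qed.

(** Since E_(n+1-k) = (q^(n-k) - X) E_(n-k), the images of X^k and X^(k+1) add up to q^(n-k) E_(n-k)
    X^k; the factor q^(-k) is absorbed by the dilation of [p]. *)
Lemma psi_1DXM n p : q != 0 -> (size p <= n.+1)%N ->
  coefsum n.+2 (T n.+1) ((1 + 'X) * p) =
  q ^+ n *: coefsum n.+1 (T n) (p \Po (q^-1 *: 'X)).
Proof.
move=> q0 sp; rewrite mulrDl mul1r linearD /= coefsumXM coefsum_recr //.
rewrite /coefsum scaler_sumr -big_split; apply: eq_bigr => k _ /=.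
have lekn : (k <= n)%N by rewrite -ltnS.
rewrite -scalerDr coef_comp_scaleX !scalerA mulrCA exprVn.
rewrite -expfB_cond ?(negPf q0) ?add0n //.
rewrite -scalerA; congr (_ *: _).
rewrite /psi_basis subSS subSn // qfallS exprS -mul_polyC; ring.
Qed.

(** Removing the factor 1 + X from A_k lowers [n] and [k] together, so [n - k] is fixed throughout
    the induction; the dilation by [q^-1] undoes the one left in the remaining product. *)
Lemma psi_qpow1 n k : q != 0 -> (k <= n)%N ->
  qtri q (n - k) *: coefsum n.+1 (T n) (A k) = qtri q n *: E (n - k).
Proof.
move=> q0; elim: k n => [|k IH] n.
  move=> _; rewrite subn0 /qpow1 big_ord0 -(expr0 'X) coefsumXn //.
  by rewrite /psi_basis subn0 mulr1.
case: n => // n lekn; rewrite subSS qpow1S_dilate psi_1DXM //; last first.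
  apply: leq_trans (size_qpow1 _ _ _) _ => //.
  by apply: leq_trans (size_scale_leq _ _) _; rewrite size_polyX.
rewrite qpow1_comp comp_polyZ comp_polyX (scalerA q) divff // scale1r.
by rewrite scalerA mulrC -scalerA IH // scalerA -qtriS.
Qed.

(** Termwise, A_k - A_(k+1) = - q^k X A_k, and q^k is absorbed by the dilation of [p]. *)
Lemma phi_1BXM m p : (size p <= m)%N ->
  coefsum m.+1 A ((1 - 'X) * p) = - 'X * coefsum m A (p \Po (q *: 'X)).
Proof.
move=> sp; rewrite mulrBl mul1r linearB /= coefsumXM coefsum_recr //.
rewrite /coefsum mulr_sumr -sumrB; apply: eq_bigr => k _.
rewrite coef_comp_scaleX qpow1S -!mul_polyC polyCM; ring.
Qed.

Lemma qfallS_dilate m :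
  E m.+1 = (1 - 'X) * \prod_(i < m) ((q ^+ i.+1)%:P - 'X).
Proof. by rewrite /qfall big_ord_recl expr0. Qed.

Lemma phi_qfall M m : (m < M)%N ->
  coefsum M A (E m) = qtri q m *: (- 'X) ^+ m.
Proof.
elim: m M => [|m IH] [//|M].
  rewrite /qfall big_ord0 -(expr0 'X) coefsumXn // /qpow1 big_ord0.
  by rewrite /qtri mul0n div0n !expr0 scale1r.
rewrite ltnS => ltmM; rewrite qfallS_dilate phi_1BXM; last first.
  by rewrite (size_prod_CsubX (fun i => q ^+ i.+1)).
(* Each of the [m] factors q^(i+1) - q X gives up one [q]. *)
have -> : (\prod_(i < m) ((q ^+ i.+1)%:P - 'X)) \Po (q *: 'X) = q ^+ m *: E m.
  rewrite rmorph_prod -[in q ^+ m](card_ord m) -prodr_const -scaler_prod.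
  apply: eq_bigr => i _ /=.
  by rewrite comp_polyB comp_polyC comp_polyX scalerBr exprS polyCM mul_polyC.
by rewrite linearZ /= IH // scalerA -qtriS -scalerAr exprS.
Qed.

(** On polynomials of degree at most [n] this is p(X) -> (-X)^n p(-1/X). *)
Definition alt_rev n : {poly F} -> {poly F} :=
  coefsum n.+1 (fun k => (- 'X) ^+ (n - k)).

HB.instance Definition _ n := GRing.Linear.on (alt_rev n).

Lemma alt_revXM n p : alt_rev n.+1 ('X * p) = alt_rev n p.
Proof. exact: coefsumXM. Qed.

Lemma alt_rev_widen n p : (size p <= n.+1)%N ->
  alt_rev n.+1 p = - 'X * alt_rev n p.
Proof.
move=> sp; rewrite /alt_rev coefsum_recr // /coefsum mulr_sumr.
apply: eq_bigr => k _; rewrite -scalerAr -exprS subSn //.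
by rewrite -ltnS.
Qed.

(** Reversal is multiplicative when degree bounds add up, and it turns the factor q^i - X into -X
    (q^i + 1/X) = - (1 + q^i X). *)
Lemma alt_rev_qfall m : alt_rev m (E m) = (- 1) ^+ m *: A m.
Proof.
elim: m => [|m IH].
  rewrite /alt_rev /qfall big_ord0 -(expr0 'X) coefsumXn //.
  by rewrite /qpow1 big_ord0 scale1r.
rewrite qfallS mulrBl mul_polyC linearB linearZ /= alt_revXM.
rewrite alt_rev_widen ?(size_prod_CsubX (GRing.exp q)) // IH qpow1S exprS.
rewrite -!mul_polyC polyCM polyCN; ring.
Qed.

Lemma alt_rev_psi_basis n k : (k <= n)%N ->
  alt_rev n (T n k) = (- 1) ^+ (n - k) *: A (n - k).
Proof.
move=> lekn; rewrite -alt_rev_qfall /psi_basis -[X in alt_rev X](subnK lekn).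
elim: k {lekn} (n - k)%N => [|k IH] m; first by rewrite addn0 mulr1.
by rewrite addnS exprS mulrCA alt_revXM IH.
Qed.

(** Both composites send X^k to (-1)^(n-k) A_(n-k). *)
Lemma alt_rev_psi n p :
  alt_rev n (coefsum n.+1 (T n) p) = coefsum n.+1 A (alt_rev n p).
Proof.
rewrite coefsum_comp [alt_rev n p]/alt_rev coefsum_comp.
apply: eq_coefsum => k; rewrite ltnS => lekn /=.
rewrite alt_rev_psi_basis // -[- 'X]scaleN1r exprZn.
by rewrite linearZ /= coefsumXn // ltnS leq_subr.
Qed.

Lemma alt_revK n p : (size p <= n.+1)%N ->
  alt_rev n (alt_rev n p) = (- 1) ^+ n *: p.
Proof.
move=> sp; rewrite -[in RHS](coefsum_id sp) coefsumZ.
rewrite [alt_rev n p]/alt_rev coefsum_comp.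
apply: eq_coefsum => k; rewrite ltnS => lekn.
rewrite -[- 'X]scaleN1r exprZn linearZ /= /alt_rev.
rewrite coefsumXn ?ltnS ?leq_subr // subKn // -[- 'X]scaleN1r exprZn.
by rewrite scalerA -exprD subnK.
Qed.

(** * The braid relation *)

Lemma phi_psi_phi n p : q != 0 ->
  coefsum n.+1 A (coefsum n.+1 (T n) (coefsum n.+1 A p)) =
  qtri q n *: alt_rev n p.
Proof.
move=> q0; rewrite /alt_rev (coefsum_comp _ _ A p) coefsum_comp coefsumZ.
apply: eq_coefsum => k; rewrite ltnS => lekn /=.
have t0 : qtri q (n - k) != 0 by rewrite expf_neq0.
(* Multiplying by the nonzero q_(n-k) makes [psi_qpow1] applicable; Phi E_(n-k) then returns the
   same factor. *)
apply: (scalerI t0); have /(congr1 (coefsum n.+1 A)) := psi_qpow1 q0 lekn.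
rewrite !linearZ /= => ->.
by rewrite phi_qfall ?ltnS ?leq_subr // !scalerA mulrC.
Qed.

Lemma braid_poly n p : q != 0 ->
  Phi_poly n q (Psi_poly n q (Phi_poly n q p)) =
  Psi_poly n q (Phi_poly n q (Psi_poly n q p)).
Proof.
move=> q0; set u := LHS; set v := RHS.
have PhiP r : Phi_poly n q r = coefsum n.+1 A r by [].
have PPP r :
    Phi_poly n q (Psi_poly n q (Phi_poly n q r)) = qtri q n *: alt_rev n r.
  by rewrite !Psi_polyE // !PhiP phi_psi_phi.
have Phi_uv : Phi_poly n q u = Phi_poly n q v.
  by rewrite /u /v !PPP Psi_polyE // alt_rev_psi PhiP linearZ.
have : alt_rev n u = alt_rev n v.
  have t0 : qtri q n != 0 by rewrite expf_neq0.
  by apply: (scalerI t0); rewrite -!PPP Phi_uv.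
move=> /(congr1 (alt_rev n)).
(* As values of Phi and Psi, [u] and [v] have degree at most [n] whatever the size of [p]. *)
rewrite !alt_revK ?size_Phi_poly ?size_Psi_poly //.
by apply: scalerI; rewrite expf_neq0 // oppr_eq0 oner_eq0.
Qed.

End QBraid.

Theorem theorem33 (R : realType) (n : nat) (q : R[i]) (hq : q != 0) :
  (Phi n q \o Psi n q \o Phi n q = Psi n q \o Phi n q \o Psi n q)%VF.
Proof.
apply/lfunP => p; rewrite !comp_lfunE !lfunE /=; apply/val_inj.
exact: braid_poly.
Qed.
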